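(* Let $r\ge2$ and let $\rho_1,\ldots,\rho_r$ be quantum states on a finite-dimensional Hilbert space $\mathcal H_A$. Let $\rho_{XA}=\frac1r\sum_{i=1}^r|i\rangle\langle i|_X\otimes\rho_i$ and $\rho_X=\operatorname{Tr}_A[\rho_{XA}]$. Then $$\exp\Big[-\inf_{\sigma\in\mathscr D}D_{1/2}(\rho_{XA}\|\rho_X\otimes\sigma)\Big]\ \ge\ \frac1r+\frac{r-1}{r}\exp\big[-\mathscr O(X;A)_\rho\big],$$ where $\mathscr O(X;A)_\rho=\inf_{\sigma\in\mathscr D}D(\rho_X\otimes\sigma\|\rho_{XA})$ is the oveloh information.
   Context: $\mathscr D$ is the set of states (positive semi-definite, unit trace) on $\mathcal H_A$; $\{|i\rangle\}_{i=1}^r$ is the standard basis of $\mathbb C^r$. $D_{1/2}(\rho\|\sigma)=-2\ln\operatorname{Tr}[\rho^{1/2}\sigma^{1/2}]$ is the Petz–Rényi relative entropy of order $1/2$. $D(\rho\|\sigma)=\operatorname{Tr}[\rho(\ln\rho-\ln\sigma)]$ if $\operatorname{supp}(\rho)\subseteq\operatorname{supp}(\sigma)$ and $+\infty$ otherwise is the quantum relative entropy. One has $\mathscr O(X;A)_\rho=\inf_{\sigma\in\mathscr D}\frac1r\sum_{i=1}^rD(\sigma\|\rho_i)$. Convention: $\exp(-\infty)=0$. *)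

(* Defs.v *)
From HB Require Import structures.
From mathcomp Require Import all_boot all_order all_algebra.
From mathcomp Require Import complex mxtens.
From mathcomp Require Import all_classical all_reals all_analysis.

Set Implicit Arguments.
Unset Strict Implicit.
Unset Printing Implicit Defensive.
Import Order.TTheory GRing.Theory Num.Theory.
Local Open Scope classical_set_scope.
Local Open Scope sesquilinear_scope.
Local Open Scope ring_scope.

(* Operators on the Hilbert space C^n are matrices 'M[R[i]]_n, and a row vector
   v stands for the bra <v|: <v|A|v> is v *m A *m v^t*, and for Hermitian A,
   v *m A = 0 iff A|v> = 0. In R[i], 0 <= z means that z is real and
   nonnegative. *)

Section Operators.
Context {R : realType}.
Local Notation C := R[i].

Definition psdmx n (A : 'M[C]_n) : Prop :=
  A \is hermsymmx /\ forall v : 'rV[C]_n, 0 <= (v *m A *m v ^t*) 0 0.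

Definition state n (rho : 'M[C]_n) : Prop := psdmx rho /\ \tr rho = 1.

(* Functional calculus f(A) for Hermitian A, whose eigenvalues are real. *)
Definition fun_mx (f : R -> R) n (A : 'M[C]_n) : 'M[C]_n :=
  invmx (spectralmx A)
  *m diag_mx (map_mx (fun z : C => (f (complex.Re z))%:C%C) (spectral_diag A))
  *m spectralmx A.

Definition sqrtmx n (A : 'M[C]_n) := fun_mx (@Num.sqrt R) A.

(* Since ln x = 0 for x <= 0, this is the logarithm of a positive semi-definite
   A on its support and 0 on its kernel: the convention 0 ln 0 = 0. *)
Definition lnmx n (A : 'M[C]_n) := fun_mx (@ln R) A.

(* Its row space is the orthogonal complement of the kernel of A. *)
Definition suppmx n (A : 'M[C]_n) : 'M[C]_n := orthomx Num.conj 1%:M (kermx A).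

(* The traces below are real for positive semi-definite arguments. *)

(* lne 0 = -oo, so orthogonal states are at distance +oo. *)
Definition petz_half n (rho sigma : 'M[C]_n) : \bar R :=
  ((- 2)%:E * lne (complex.Re (\tr (sqrtmx rho *m sqrtmx sigma)))%:E)%E.

Definition rel_entropy n (rho sigma : 'M[C]_n) : \bar R :=
  if (suppmx rho <= suppmx sigma)%MS then
    (complex.Re (\tr (rho *m (lnmx rho - lnmx sigma))))%:E
  else +oo%E.

(* C^r (x) C^d is C^(r * d), with basis |i>|k> at mxtens_index (i, k). *)
Definition ptraceA r d (M : 'M[C]_(r * d)) : 'M[C]_r :=
  \matrix_(i, j) \sum_(k < d) M (mxtens_index (i, k)) (mxtens_index (j, k)).

Definition cq_state r d (rho : 'I_r -> 'M[C]_d) : 'M[C]_(r * d) :=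
  r%:R^-1 *: \sum_(i < r) (delta_mx i i *t rho i).

Definition oveloh r d (rhoXA : 'M[C]_(r * d)) : \bar R :=
  ereal_inf [set rel_entropy (ptraceA rhoXA *t sigma) rhoXA
            | sigma in [set sigma : 'M[C]_d | state sigma]].

End Operators.

(* Main.v *)
Require Import Defs.
From HB Require Import structures.
From mathcomp Require Import all_boot all_order all_algebra.
From mathcomp Require Import complex mxtens.
From mathcomp Require Import all_classical all_reals all_analysis.
From mathcomp Require Import ring lra.

Set Implicit Arguments.
Unset Strict Implicit.
Unset Printing Implicit Defensive.
Import Order.TTheory GRing.Theory Num.Theory.
Local Open Scope classical_set_scope.
Local Open Scope ring_scope.

(* For block-diagonal states everything reduces to the pair overlaps
   f_ij = Tr[rho_i^(1/2) rho_j^(1/2)]. The choice sigma = S^2 / Tr S^2 with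
   S = sum_i rho_i^(1/2) gives the value (1/r^2) sum_ij f_ij on the left-hand
   side, and f_ii = 1 accounts for the term 1/r. For i <> j one has
     f_ij >= exp (- (D(sigma|rho_i) + D(sigma|rho_j)) / 2)   for every sigma,
   which is the Golden-Thompson inequality in variational form; Jensen's
   inequality over the pairs i <> j then gives the claim.

   The variational form is proved directly: with A_m = e^(H/m), B_m = e^(K/m)
   and m = 2^k, iterated Cauchy-Schwarz gives Tr (A_m B_m)^m <= Tr e^H e^K,
   while in any orthonormal basis (e_k) the left-hand side is bounded below by
   quantities tending to sum_k exp <e_k|H + K|e_k>; the eigenbasis of sigma and
   Gibbs' inequality conclude. Logarithms of singular states are regularised on
   the kernel. *)

(** * Iterated Cauchy-Schwarz for traces *)

Section ConjugateTranspose.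
Local Open Scope sesquilinear_scope.
Context {C : numClosedFieldType}.

Lemma adj_mul m n p (A : 'M[C]_(m, n)) (B : 'M[C]_(n, p)) :
  (A *m B)^t* = B^t* *m A^t*.
Proof. by rewrite trmx_mul map_mxM. Qed.

Lemma adj_exp n (A : 'M[C]_n) k : (A ^+ k)^t* = A^t* ^+ k.
Proof.
elim: k => [|k IHk]; first by rewrite !expr0 trmx1 map_mx1.
by rewrite exprS exprSr -!mulmxE adj_mul IHk.
Qed.

Lemma mxtrace_adj n (A : 'M[C]_n) : \tr (A^t*) = (\tr A)^*.
Proof. by rewrite rmorph_sum /=; apply: eq_bigr => i _; rewrite !mxE. Qed.

Lemma hermsymmxP n (A : 'M[C]_n) : reflect (A^t* = A) (A \is hermsymmx).
Proof.
by rewrite qualifE /= expr0 scale1r eq_sym; apply: eqP.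
Qed.

Lemma mxtrace_mul_adjE m n (A : 'M[C]_(m, n)) :
  \tr (A *m A^t*) = \sum_i \sum_j `|A i j| ^+ 2.
Proof.
apply: eq_bigr => i _; rewrite mxE; apply: eq_bigr => j _.
by rewrite !mxE normCK.
Qed.

Lemma mxtrace_mul_adj_ge0 m n (A : 'M[C]_(m, n)) : 0 <= \tr (A *m A^t*).
Proof.
by rewrite mxtrace_mul_adjE; do 2!apply: sumr_ge0 => ? _; rewrite exprn_ge0.
Qed.

(** Entrywise [2|a||b| <= |a|^2 + |b|^2]. A common bound [c], in place of the product of the two
    norms, keeps square roots out of the iteration below. *)
Lemma norm_mxtrace_mul_le n (A B : 'M[C]_n) c :
  \tr (A *m A^t*) <= c -> \tr (B *m B^t*) <= c -> `|\tr (A *m B)| <= c.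
Proof.
move=> Ac Bc; suff: `|\tr (A *m B)| *+ 2 <= c + c.
  by rewrite -mulr2n lerMn2r.
apply: le_trans (lerD Ac Bc); rewrite !mxtrace_mul_adjE [X in _ + X]exchange_big.
rewrite -big_split -normrMn -sumrMnl; apply: le_trans (ler_norm_sum _ _ _) _.
apply: ler_sum => i _; rewrite /= mxE -big_split -sumrMnl.
apply: le_trans (ler_norm_sum _ _ _) _; apply: ler_sum => j _ /=.
rewrite normrMn normrM -subr_ge0.
have -> : `|A i j| ^+ 2 + `|B j i| ^+ 2 - `|A i j| * `|B j i| *+ 2 =
  (`|A i j| - `|B j i|) ^+ 2 by ring.
by rewrite real_exprn_even_ge0 // rpredB // normr_real.
Qed.

Lemma mxtrace_mulX_comm n (A B : 'M[C]_n) k :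
  \tr ((A *m B) ^+ k) = \tr ((B *m A) ^+ k).
Proof.
case: k => [|k]; first by rewrite !expr0.
have comm j : (A *m B) ^+ j *m A = A *m (B *m A) ^+ j.
  elim: j => [|j IHj]; first by rewrite !expr0 mul1mx mulmx1.
  by rewrite !exprS -!mulmxE -mulmxA IHj !mulmxA.
by rewrite exprSr -mulmxE mulmxA comm mxtrace_mulC mulmxA exprS -mulmxE.
Qed.

(* The case p = 2^(j+1) of Hoelder's inequality for the Schatten norm applied
   to the word PQPQ...PQ of length p, by iterating Cauchy-Schwarz: pairing
   letters turns it into the word (PQ)(PQ)...(PQ) of half the length. *)
Lemma norm_mxtrace_mulX_le n (j : nat) : forall (P Q : 'M[C]_n) c,
  \tr ((P *m P^t*) ^+ (2 ^ j)) <= c -> \tr ((Q *m Q^t*) ^+ (2 ^ j)) <= c ->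
  `|\tr ((P *m Q) ^+ (2 ^ j))| <= c.
Proof.
elim: j => [|j IHj] P Q c; first by rewrite !expr1; apply: norm_mxtrace_mul_le.
rewrite !expnS !exprM !expr2 -!mulmxE => Pc Qc.
have herm_real (Y : 'M[C]_n) k : \tr ((Y *m Y^t*) ^+ k) \is Num.real.
  by apply/CrealP; rewrite -mxtrace_adj adj_exp adj_mul trmxCK.
suff PQc : \tr (((P *m Q) *m (P *m Q)^t*) ^+ (2 ^ j)) <= c by exact: IHj.
have PQE : (P *m Q) *m (P *m Q)^t* = P *m ((Q *m Q^t*) *m P^t*).
  by rewrite adj_mul !mulmxA.
apply: le_trans (real_ler_norm (herm_real _ _)) _; rewrite PQE.
rewrite mxtrace_mulX_comm -mulmxA; apply: IHj; rewrite adj_mul trmxCK //.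
set X := P^t* *m P; suff -> : X *m X = P^t* *m (P *m P^t* *m P).
  by rewrite mxtrace_mulX_comm -mulmxA.
by rewrite /X !mulmxA.
Qed.

End ConjugateTranspose.

(** * Functional calculus *)

Section FunctionalCalculus.
Local Open Scope sesquilinear_scope.
Context {R : realType}.
Local Notation C := R[i].

Lemma Re_add (x y : C) : complex.Re (x + y) = complex.Re x + complex.Re y.
Proof. by case: x y => [? ?] [? ?]. Qed.

Lemma Re_opp (x : C) : complex.Re (- x) = - complex.Re x.
Proof. by case: x. Qed.

Lemma Re_sum I (s : seq I) (P : pred I) (F : I -> C) :
  complex.Re (\sum_(i <- s | P i) F i) = \sum_(i <- s | P i) complex.Re (F i).
Proof. by apply: (big_morph _ Re_add). Qed.

Lemma Re_mulr_real (x : R) (y : C) : complex.Re (x%:C%C * y) = x * complex.Re y.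
Proof. by case: y => a b /=; rewrite mul0r subr0. Qed.

Lemma ge0_Re (x : C) : 0 <= x -> 0 <= complex.Re x.
Proof. by rewrite lecE => /andP[]. Qed.

Lemma conj_real_complex (x : R) : (x%:C%C : C)^* = x%:C%C.
Proof. by rewrite conj_Creal //; apply/complex_realP; exists x. Qed.

Definition rdiag n (e : 'I_n -> R) : 'M[C]_n := diag_mx (\row_i (e i)%:C%C).

Lemma rdiagE n (e : 'I_n -> R) i j : rdiag e i j = (e i)%:C%C *+ (i == j).
Proof. by rewrite !mxE. Qed.

Lemma mul_rdiag n (e f : 'I_n -> R) :
  rdiag e *m rdiag f = rdiag (fun i => e i * f i).
Proof.
rewrite /rdiag mulmx_diag; congr diag_mx; apply/rowP => i.
by rewrite !mxE rmorphM.
Qed.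

Lemma rdiagD n (e f : 'I_n -> R) :
  rdiag e + rdiag f = rdiag (fun i => e i + f i).
Proof. by apply/matrixP => i j; rewrite mxE !rdiagE rmorphD mulrnDl. Qed.

Lemma rdiagZ n c (e : 'I_n -> R) : c%:C%C *: rdiag e = rdiag (fun i => c * e i).
Proof. by apply/matrixP => i j; rewrite mxE !rdiagE rmorphM mulrnAr. Qed.

Lemma eq_rdiag n (e f : 'I_n -> R) : e =1 f -> rdiag e = rdiag f.
Proof. by move=> ef; apply/matrixP => i j; rewrite !rdiagE ef. Qed.

Lemma rdiag_adj n (e : 'I_n -> R) : (rdiag e)^t* = rdiag e.
Proof.
apply/matrixP => i j; rewrite !mxE eq_sym; case: eqP => [->|_].
  by rewrite !mulr1n conj_real_complex.
by rewrite !mulr0n conjC0.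
Qed.

Definition eigval n (A : 'M[C]_n) (i : 'I_n) : R :=
  complex.Re (spectral_diag A 0 i).

Lemma invmx_spectralmx n (A : 'M[C]_n) :
  invmx (spectralmx A) = (spectralmx A)^t*.
Proof. exact: (invmx_unitary (spectral_unitarymx A)). Qed.

(* Locked, so that comparing [fcalc f A] with [fcalc g B] never unfolds the
   spectral decompositions. *)
Fact fcalc_key : unit. Proof. by []. Qed.
Definition fcalc : (R -> R) -> forall n, 'M[C]_n -> 'M[C]_n :=
  locked_with fcalc_key (@fun_mx R).
Arguments fcalc f {n} A.

Lemma fun_mx_fcalc f n (A : 'M[C]_n) : fun_mx f A = fcalc f A.
Proof. by rewrite /fcalc unlock. Qed.

Lemma fcalcE f n (A : 'M[C]_n) :
  fcalc f A =
    (spectralmx A)^t* *m rdiag (fun i => f (eigval A i)) *m spectralmx A.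
Proof.
rewrite -fun_mx_fcalc /fun_mx invmx_spectralmx /rdiag.
by have -> : map_mx (fun z : C => (f (complex.Re z))%:C%C) (spectral_diag A) =
  \row_i (f (eigval A i))%:C%C by apply/rowP => i; rewrite !mxE.
Qed.

Lemma spectralmxKV n (A : 'M[C]_n) : spectralmx A *m (spectralmx A)^t* = 1%:M.
Proof. exact/unitarymxP/spectral_unitarymx. Qed.

Lemma spectralmxVK n (A : 'M[C]_n) : (spectralmx A)^t* *m spectralmx A = 1%:M.
Proof.
by rewrite -invmx_spectralmx mulVmx ?spectral_unit.
Qed.

Lemma fcalc_id n (A : 'M[C]_n) : A \is hermsymmx -> fcalc id A = A.
Proof.
move=> hA; have /hermitian_normalmx/orthomx_spectralP {2}-> := hA.
rewrite fcalcE invmx_spectralmx /rdiag.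
have -> // : \row_i (eigval A i)%:C%C = spectral_diag A.
apply/rowP => i; rewrite mxE RRe_real //.
exact/mxOverP/hermitian_spectral_diag_real.
Qed.

Lemma fcalcM f g n (A : 'M[C]_n) :
  fcalc f A *m fcalc g A = fcalc (fun x => f x * g x) A.
Proof.
rewrite !fcalcE -mul_rdiag; move: (spectralmxKV A).
move: (spectralmx A) (rdiag _) (rdiag _) => U D E UU.
by rewrite -!mulmxA (mulmxA U) UU mul1mx.
Qed.

Lemma fcalcD f g n (A : 'M[C]_n) :
  fcalc f A + fcalc g A = fcalc (fun x => f x + g x) A.
Proof.
rewrite !fcalcE -rdiagD; move: (spectralmx A) (rdiag _) (rdiag _) => U D E.
by rewrite mulmxDr mulmxDl.
Qed.

Lemma fcalcZ c f n (A : 'M[C]_n) :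
  c%:C%C *: fcalc f A = fcalc (fun x => c * f x) A.
Proof.
rewrite !fcalcE -rdiagZ; move: (spectralmx A) (rdiag _) => U D.
by rewrite -scalemxAr -scalemxAl.
Qed.

Lemma eq_fcalc f g n (A : 'M[C]_n) :
  (forall i, f (eigval A i) = g (eigval A i)) -> fcalc f A = fcalc g A.
Proof.
by move=> fg; rewrite !fcalcE (eq_rdiag fg).
Qed.

Lemma fcalc_cst c n (A : 'M[C]_n) : fcalc (fun=> c) A = c%:C%C%:M.
Proof.
rewrite fcalcE; have -> : rdiag (fun _ : 'I_n => c) = c%:C%C%:M.
  by apply/matrixP => i j; rewrite rdiagE !mxE.
by rewrite mul_mx_scalar -scalemxAl spectralmxVK scalemx1.
Qed.

Lemma fcalc_adj f n (A : 'M[C]_n) : (fcalc f A)^t* = fcalc f A.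
Proof. by rewrite fcalcE !adj_mul trmxCK rdiag_adj mulmxA. Qed.

Lemma fcalc_herm f n (A : 'M[C]_n) : fcalc f A \is hermsymmx.
Proof. exact/hermsymmxP/fcalc_adj. Qed.

(* Intertwining: D W = W D' for diagonal D, D' forces W to vanish off the pairs
   of equal eigenvalues, hence f(D) W = W f(D'). *)
Lemma fcalc_diagonalization f n (A V : 'M[C]_n) (e : 'I_n -> R) :
    A \is hermsymmx -> V \in unitmx -> A = invmx V *m rdiag e *m V ->
  fcalc f A = invmx V *m rdiag (fun i => f (e i)) *m V.
Proof.
move=> hA uV AE; set U := spectralmx A; pose W := V *m U^t*.
have WU : W *m U = V by rewrite /W -mulmxA spectralmxVK mulmx1.
have WE : rdiag e *m W = W *m rdiag (eigval A).
  have : V *m A *m U^t* = rdiag e *m W.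
    by rewrite {1}AE /W; move: (rdiag e) => D; rewrite !mulmxA mulmxV // mul1mx.
  rewrite -{1}[A]fcalc_id // fcalcE !mulmxA -/W => <-.
  by rewrite -[LHS]mulmxA spectralmxKV mulmx1.
suff fWE : rdiag (fun i => f (e i)) *m W = W *m rdiag (fun i => f (eigval A i)).
  have VW : invmx V *m W = U^t* by rewrite mulKmx.
  rewrite fcalcE -/U; move: fWE; move: (rdiag _) (rdiag _) => D E fWE.
  by rewrite -VW -(mulmxA _ W) -fWE -!mulmxA spectralmxVK mulmx1.
move: W {WU} WE => W WE; apply/matrixP => i j; move/matrixP/(_ i j): WE.
rewrite /rdiag !mul_diag_mx !mul_mx_diag !mxE.
have [->|Wij] := eqVneq (W i j) 0; first by rewrite !mulr0 !mul0r.
by rewrite mulrC => /(mulfI Wij)/complexI ->; rewrite mulrC.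
Qed.

Lemma fcalc_comp f g n (A : 'M[C]_n) :
  fcalc f (fcalc g A) = fcalc (fun x => f (g x)) A.
Proof.
rewrite (@fcalc_diagonalization f _ _ (spectralmx A) (fun i => g (eigval A i))).
- by rewrite fcalcE invmx_spectralmx.
- exact: fcalc_herm.
- exact: spectral_unit.
- by rewrite fcalcE invmx_spectralmx.
Qed.

Lemma fcalc_scale f c n (A : 'M[C]_n) : A \is hermsymmx ->
  fcalc f (c%:C%C *: A) = fcalc (fun x => f (c * x)) A.
Proof.
move=> hA; transitivity (fcalc f (c%:C%C *: fcalc id A)).
  by rewrite fcalc_id.
by rewrite fcalcZ fcalc_comp.
Qed.

Fact qform_key : unit. Proof. by []. Qed.
(** The real part makes the form real-valued on products of Hermitian matrices, which need not be
    Hermitian, and invariant under the adjoint. *)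
Definition qform : forall n, 'rV[C]_n -> 'M[C]_n -> R :=
  locked_with qform_key (fun n v A => complex.Re ((v *m A *m v^t*) 0 0)).
Arguments qform {n} v A.

Lemma qformE n (v : 'rV[C]_n) A :
  qform v A = complex.Re ((v *m A *m v^t*) 0 0).
Proof. by rewrite /qform unlock. Qed.

Lemma qformD n (v : 'rV[C]_n) A B : qform v (A + B) = qform v A + qform v B.
Proof. by rewrite !qformE mulmxDr mulmxDl mxE Re_add. Qed.

Lemma qformZ n (v : 'rV[C]_n) c A : qform v (c%:C%C *: A) = c * qform v A.
Proof. by rewrite !qformE -scalemxAr -scalemxAl mxE Re_mulr_real. Qed.

Definition normsq (z : C) : R := complex.Re z ^+ 2 + complex.Im z ^+ 2.

Lemma normsqE z : (normsq z)%:C%C = `|z| ^+ 2.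
Proof. exact: add_Re2_Im2. Qed.

Lemma normsq_ge0 z : 0 <= normsq z.
Proof. by rewrite addr_ge0 // sqr_ge0. Qed.

(** The squared moduli of the coordinates of [v] in the eigenbasis are the weights of its spectral
    measure. *)
Lemma mul_fcalc_adjE n (v : 'rV[C]_n) f (A : 'M[C]_n) :
  (v *m fcalc f A *m v^t*) 0 0 =
    (\sum_i f (eigval A i) * normsq ((v *m (spectralmx A)^t*) 0 i))%:C%C.
Proof.
rewrite fcalcE; move: (spectralmx A) (eigval A) => U e.
rewrite !mulmxA -mulmxA -[X in _ *m (X *m _)]trmxCK -adj_mul.
move: (v *m U^t*) => w.
rewrite mxE rmorph_sum /=; apply: eq_bigr => i _.
rewrite /rdiag mul_mx_diag !mxE rmorphM /= normsqE normCK.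
by rewrite mulrAC mulrC.
Qed.

Lemma qform_fcalc n (v : 'rV[C]_n) f (A : 'M[C]_n) :
  qform v (fcalc f A) =
    \sum_i f (eigval A i) * normsq ((v *m (spectralmx A)^t*) 0 i).
Proof. by rewrite !qformE mul_fcalc_adjE. Qed.

Lemma qform_row n (M X : 'M[C]_n) i :
  qform (row i M) X = complex.Re ((M *m X *m M^t*) i i).
Proof.
rewrite !qformE -row_mul; congr complex.Re; rewrite mxE [RHS]mxE.
by apply: eq_bigr => k _; rewrite [row _ _ _ _]mxE; congr (_ * _); rewrite !mxE.
Qed.

Lemma ler_qform_fcalc n (v : 'rV[C]_n) f g (A : 'M[C]_n) :
  (forall x, f x <= g x) -> qform v (fcalc f A) <= qform v (fcalc g A).
Proof.
move=> fg; rewrite !qform_fcalc.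
apply: ler_sum => i _; exact: (ler_wpM2r (normsq_ge0 _) (fg _)).
Qed.

Lemma mxtrace_fcalc_mul f n (A X : 'M[C]_n) :
  complex.Re (\tr (fcalc f A *m X)) =
    \sum_i f (eigval A i) * qform (row i (spectralmx A)) X.
Proof.
rewrite fcalcE -!mulmxA mxtrace_mulC -!mulmxA Re_sum.
apply: eq_bigr => i _; rewrite /rdiag mul_diag_mx qform_row -mulmxA.
by rewrite mxE [X in X * _]mxE Re_mulr_real.
Qed.

Lemma mxtrace_fcalc f n (A : 'M[C]_n) :
  complex.Re (\tr (fcalc f A)) = \sum_i f (eigval A i).
Proof.
rewrite fcalcE mxtrace_mulC mulmxA spectralmxKV mul1mx Re_sum.
by apply: eq_bigr => i _; rewrite rdiagE eqxx.
Qed.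

Lemma qform_row_spectralmx n (A : 'M[C]_n) i :
  A \is hermsymmx -> qform (row i (spectralmx A)) A = eigval A i.
Proof.
move=> hA; rewrite qform_row -{2}[A]fcalc_id // fcalcE.
move: (spectralmx A) (spectralmxKV A) (eigval A) => U UU e.
by rewrite -!mulmxA UU mulmx1 mulmxA UU mul1mx rdiagE eqxx.
Qed.

Lemma psdmx_herm n (A : 'M[C]_n) : psdmx A -> A \is hermsymmx.
Proof. by case. Qed.

Lemma psdmx_eigval_ge0 n (A : 'M[C]_n) i : psdmx A -> 0 <= eigval A i.
Proof.
by move=> [hA pA]; rewrite -qform_row_spectralmx // qformE; apply/ge0_Re/pA.
Qed.

Lemma psdmx_eq_fcalc f g n (A : 'M[C]_n) : psdmx A ->
  (forall x, 0 <= x -> f x = g x) -> fcalc f A = fcalc g A.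
Proof. by move=> pA fg; apply: eq_fcalc => i; apply/fg/psdmx_eigval_ge0. Qed.

Lemma psdmx_fcalc f n (A : 'M[C]_n) :
  (forall i, 0 <= f (eigval A i)) -> psdmx (fcalc f A).
Proof.
move=> f0; split=> [|v]; first exact: fcalc_herm.
rewrite mul_fcalc_adjE ler0c; apply: sumr_ge0 => i _.
by rewrite mulr_ge0 ?normsq_ge0.
Qed.

End FunctionalCalculus.

(** * The Golden-Thompson inequality *)

Section GoldenThompson.
Local Open Scope sesquilinear_scope.
Context {R : realType}.
Local Notation C := R[i].

Lemma Re_le_norm (z c : C) : `|z| <= c -> complex.Re z <= complex.Re c.
Proof.
move=> zc; have := le_trans (normc_ge_Re z) zc.
by rewrite lecE => /andP[_]; apply: le_trans; rewrite ler_norm.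
Qed.

(** The doubling step of Golden-Thompson: take both letters of the Schatten bound equal to
    [P = H K]; cyclically, [P P^*] is [H^2 K^2]. *)
Lemma Re_mxtrace_mulX_le n (H K : 'M[C]_n) j :
    H^t* = H -> K^t* = K ->
  complex.Re (\tr ((H *m K) ^+ (2 ^ j.+1))) <=
  complex.Re (\tr (((H *m H) *m (K *m K)) ^+ (2 ^ j))).
Proof.
move=> hH hK; set P := H *m K.
have -> : \tr (((H *m H) *m (K *m K)) ^+ (2 ^ j)) = \tr ((P *m P^t*) ^+ (2 ^ j)).
  by rewrite /P adj_mul hH hK -!mulmxA mxtrace_mulX_comm !mulmxA.
by apply: Re_le_norm; rewrite expnS exprM expr2 -mulmxE; apply: norm_mxtrace_mulX_le.
Qed.

Lemma qform_mul_adj n (v : 'rV[C]_n) (M : 'M[C]_n) :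
  qform v (M *m M^t*) = \sum_i normsq ((v *m M) 0 i).
Proof.
rewrite qformE mulmxA -mulmxA -adj_mul mxE Re_sum; apply: eq_bigr => i _.
by rewrite !mxE -normCK -normsqE.
Qed.

Lemma qform_mul_adj_ge0 n (v : 'rV[C]_n) (M : 'M[C]_n) :
  0 <= qform v (M *m M^t*).
Proof. by rewrite qform_mul_adj; apply: sumr_ge0 => i _; apply: normsq_ge0. Qed.

Lemma qform_adj n (v : 'rV[C]_n) (M : 'M[C]_n) : qform v (M^t*) = qform v M.
Proof.
rewrite !qformE; have -> : v *m M^t* *m v^t* = (v *m M *m v^t*)^t*.
  by rewrite !adj_mul trmxCK mulmxA.
by rewrite !mxE; case: (\sum_j _).
Qed.

Lemma qform_cst n (v : 'rV[C]_n) (c : R) :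
  v *m v^t* = 1%:M -> qform v (c%:C%C%:M) = c.
Proof. by move=> v1; rewrite qformE mul_mx_scalar -scalemxAl v1 !mxE mulr1. Qed.

(** A variance is nonnegative: expand the form at [(M - c)(M - c)^*] with [c] the mean. *)
Lemma qform_sqr_le n (v : 'rV[C]_n) (M : 'M[C]_n) :
  v *m v^t* = 1%:M -> qform v M ^+ 2 <= qform v (M *m M^t*).
Proof.
move=> v1; set c := qform v M.
have := qform_mul_adj_ge0 v (M - c%:C%C%:M).
have -> : (M - c%:C%C%:M)^t* = M^t* - c%:C%C%:M.
  by rewrite linearB /= map_mxB tr_scalar_mx map_scalar_mx /= conj_real_complex.
have -> : (M - c%:C%C%:M) *m (M^t* - c%:C%C%:M) =
    M *m M^t* + (- c)%:C%C *: M + (- c)%:C%C *: M^t* + (c ^+ 2)%:C%C%:M.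
  rewrite mulmxBl !mulmxBr mul_mx_scalar mul_scalar_mx -scalar_mxM.
  rewrite rmorphN !scaleNr rmorphXn -expr2 opprB.
  by rewrite -!addrA; congr (_ + (_ + _)); rewrite addrC.
by rewrite !qformD !qformZ qform_adj qform_cst // -/c; nra.
Qed.

(** Jensen's inequality for a power of two, by repeated squaring. *)
Lemma qformX_le n (v : 'rV[C]_n) j : v *m v^t* = 1%:M ->
  forall X : 'M[C]_n, X^t* = X -> qform v X ^+ (2 ^ j) <= qform v (X ^+ (2 ^ j)).
Proof.
move=> v1; elim: j => [|j IHj] X hX; first by rewrite !expr1.
rewrite !expnS !exprM.
have XX : (X ^+ 2)^t* = X ^+ 2 by rewrite adj_exp hX.
have XXE : X ^+ 2 = X *m X^t* by rewrite hX expr2 mulmxE.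
apply: le_trans (IHj _ XX); rewrite lerXn2r ?nnegrE ?sqr_ge0 // XXE.
  exact: qform_mul_adj_ge0.
exact: qform_sqr_le.
Qed.

Lemma qform_mul_ge n (v : 'rV[C]_n) (P Q : 'M[C]_n) : P^t* = P -> Q^t* = Q ->
  - (qform v (P *m P) + qform v (Q *m Q)) / 2 <= qform v (P *m Q).
Proof.
move=> hP hQ; have := qform_mul_adj_ge0 v (P + Q).
have -> : (P + Q)^t* = P + Q by rewrite linearD /= map_mxD hP hQ.
rewrite mulmxDl !mulmxDr !qformD -(qform_adj v (Q *m P)) adj_mul hP hQ.
lra.
Qed.

(** Reduces to [|e^x - 1| <= |x| e^|x|] at [x = t y]; the factor [e^|y|] makes the estimate uniform
    in [t]. *)
Lemma expR_sub1_sqr_le (t y : R) : 0 <= t <= 1 ->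
  (expR (t * y) - 1) ^+ 2 <= t ^+ 2 * (y * expR `|y|) ^+ 2.
Proof.
move=> /andP[t0 t1]; rewrite -exprMn -[leLHS]real_normK ?num_real //.
rewrite -[leRHS]real_normK ?num_real // lerXn2r ?nnegrE //.
rewrite !normrM (ger0_norm t0) (ger0_norm (expR_ge0 _)) mulrA.
have ty : `|t * y| <= `|y| by rewrite normrM ger0_norm // ler_piMl.
have -> : t * `|y| = `|t * y| by rewrite normrM ger0_norm.
apply: (@le_trans _ _ (`|t * y| * expR `|t * y|)); last first.
  by rewrite ler_wpM2l // ler_expR.
move: (t * y) => x {ty}.
have [x0|x0] := leP 0 x.
  have ex1 : 1 <= expR x by rewrite -expR0 ler_expR.
  rewrite ger0_norm ?subr_ge0 // (ger0_norm x0).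
  have := expR_ge1Dx (- x); rewrite -(ler_pM2r (expR_gt0 x)).
  rewrite expRN mulVf ?gt_eqF ?expR_gt0 //; nra.
have ex1 : expR x <= 1 by rewrite -expR0 ler_expR ltW.
rewrite ler0_norm ?subr_le0 // (ltr0_norm x0).
have := expR_ge1Dx x; have : 1 <= expR (- x) by rewrite -expR0 ler_expR; lra.
nra.
Qed.

(** Multiplied by [t^2], it bounds [(exp (t * a x) - 1)^2] uniformly in [0 <= t <= 1]. *)
Definition expdev (a : R -> R) (x : R) : R := (a x * expR `|a x|) ^+ 2.

(** Write each exponential as 1 plus a remainder. By [1 + x <= e^x] the remainders are at least
    their linear parts, and by [qform_mul_ge] their product costs only order [t^2]. *)
Lemma qform_expR_mul_ge n (v : 'rV[C]_n) (A B : 'M[C]_n) (a b : R -> R) t :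
    v *m v^t* = 1%:M -> 0 <= t <= 1 ->
  1 + t * (qform v (fcalc a A) + qform v (fcalc b B))
    - t ^+ 2 * ((qform v (fcalc (expdev a) A) + qform v (fcalc (expdev b) B)) / 2)
  <= qform v (fcalc (fun x => expR (t * a x)) A
              *m fcalc (fun x => expR (t * b x)) B).
Proof.
move=> v1 t01.
have lin f X : 1 + t * qform v (fcalc f X) <=
    qform v (fcalc (fun x => expR (t * f x)) X).
  have -> : 1 + t * qform v (fcalc f X) = qform v (fcalc (fun x => 1 + t * f x) X).
    by rewrite -fcalcD fcalc_cst qformD qform_cst // -fcalcZ qformZ.
  by apply: ler_qform_fcalc => x; exact: expR_ge1Dx.
have dev f X : qform v (fcalc (fun x => (expR (t * f x) - 1)) X
      *m fcalc (fun x => (expR (t * f x) - 1)) X) <=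
    t ^+ 2 * qform v (fcalc (expdev f) X).
  rewrite fcalcM -qformZ fcalcZ; apply: ler_qform_fcalc => x.
  by rewrite -expr2 expR_sub1_sqr_le.
have split f X : fcalc (fun x => expR (t * f x)) X =
    1%:M + fcalc (fun x => expR (t * f x) - 1) X.
  rewrite -[1%:M](fcalc_cst 1 X) fcalcD; apply: eq_fcalc => i.
  by rewrite addrC subrK.
have := qform_mul_ge v (fcalc_adj (fun x => expR (t * a x) - 1) A)
  (fcalc_adj (fun x => expR (t * b x) - 1) B).
have := dev a A; have := dev b B; have := lin a A; have := lin b B.
rewrite !split mulmxDl mul1mx mulmxDr mulmx1 !qformD.
have -> : qform v 1%:M = 1 by apply: (qform_cst 1 v1).
lra.
Qed.

End GoldenThompson.

(** * The variational Golden-Thompson bound along powers of two, with explicit error terms *)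

Section GoldenThompsonPeierls.
Local Open Scope sesquilinear_scope.
Context {R : realType}.
Local Notation C := R[i].

(** A quantitative form of [(1 + h/M - c/M^2)^M -> e^h]: the constant [K] depends only on [h] and
    [c], so the limit becomes an epsilon argument. *)
Lemma expR_le_exprn (h c : R) : 0 <= c ->
  exists2 K : R, 0 <= K & forall (M : nat) z, (0 < M)%N -> K <= M%:R ->
    1 + M%:R^-1 * h - M%:R^-1 ^+ 2 * c <= z -> expR h * (1 - K / M%:R) <= z ^+ M.
Proof.
move=> c0; pose g := `|h| + c.
have g0 : 0 <= g by rewrite addr_ge0.
(* [2 g] forces [|u| <= 1/2], [2 g^2] pays for the second-order loss in [ln (1 + u)], and [c] for
   the quadratic term of [u]. *)
exists (c + 2 * g ^+ 2 + 2 * g) => [|M z M0 KM]; first by have := sqr_ge0 g; lra.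
set K := (X in X <= _) in KM *; set t := M%:R^-1; set u := t * h - t ^+ 2 * c.
have Mp : 0 < M%:R :> R by rewrite ltr0n.
have tp : 0 < t by rewrite invr_gt0.
have t1 : t <= 1 by rewrite invf_le1 // ler1n.
have tK : t * K <= 1 by rewrite mulrC ler_pdivrMr // mul1r.
have hu : `|u| <= t * g.
  apply: le_trans (ler_normB _ _) _; rewrite !normrM (ger0_norm (ltW tp)).
  by rewrite (ger0_norm c0) /g mulrDr lerD2l ler_wpM2r // ler_piMl // ltW.
have gK : t * g <= 1 / 2.
  have := mulr_ge0 (ltW tp) c0; have := mulr_ge0 (ltW tp) (sqr_ge0 g).
  by move: tK; rewrite /K; lra.
have ub : - (1 / 2) <= u.
  by have := ler_norm (- u); rewrite normrN; lra.
have u1 : 0 < 1 + u by lra.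
rewrite -addrA -/u => uz.
(* That is, [ln (1 + u) >= u / (1 + u) = u - u^2 / (1 + u)]. *)
have e1 : expR (u / (1 + u)) <= 1 + u.
  have := expR_ge1Dx (- (u / (1 + u))); rewrite expRN.
  have -> : 1 + - (u / (1 + u)) = (1 + u)^-1 by field; rewrite gt_eqF.
  by rewrite lef_pV2 ?posrE ?expR_gt0.
apply: (@le_trans _ _ (expR (u / (1 + u)) ^+ M)); last first.
  by rewrite lerXn2r ?nnegrE ?expR_ge0 // ?(le_trans e1) // (le_trans (ltW u1)).
apply: (@le_trans _ _ (expR h * expR (- (K / M%:R)))).
  by rewrite ler_wpM2l ?expR_ge0 // expR_ge1Dx.
rewrite -expRM_natl -expRD ler_expR -/t.
have u2 : u ^+ 2 <= (t * g) ^+ 2.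
  by rewrite -[leLHS]real_normK ?num_real // lerXn2r ?nnegrE // mulr_ge0 // ltW.
have -> : u / (1 + u) = u - u ^+ 2 / (1 + u) by field; rewrite gt_eqF.
have u3 : u ^+ 2 / (1 + u) <= 2 * (t * g) ^+ 2.
  have ub2 : 0 <= 1 + 2 * u by lra.
  by rewrite ler_pdivrMr //; have := mulr_ge0 (sqr_ge0 (t * g)) ub2; lra.
have Mt : M%:R * t = 1 by rewrite mulfV // gt_eqF.
have -> : h = M%:R * (t * h) by rewrite mulrA Mt mul1r.
have -> : K * t = M%:R * (t ^+ 2 * K) by rewrite mulrA expr2 mulrA Mt mul1r mulrC.
rewrite -mulrBr ler_pM2l //.
apply: le_trans (_ : u - 2 * (t * g) ^+ 2 <= _); last by lra.
by rewrite /u /K; have := mulr_ge0 (sqr_ge0 t) g0; lra.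
Qed.

(** [E i] and [F i] model [e^(H/2^i)] and [e^(K/2^i)]: each term squares to its predecessor, so the
    doubling steps telescope. *)
Lemma Re_mxtrace_dyadic_le n (E F : nat -> 'M[C]_n) j :
    (forall i, (E i)^t* = E i) -> (forall i, (F i)^t* = F i) ->
    (forall i, E i.+1 *m E i.+1 = E i) -> (forall i, F i.+1 *m F i.+1 = F i) ->
  complex.Re (\tr ((E j *m F j) ^+ (2 ^ j))) <= complex.Re (\tr (E 0 *m F 0)).
Proof.
move=> hE hF EE FF; elim: j => [|j IHj]; first by rewrite expr1.
apply: le_trans IHj; rewrite -[E j]EE -[F j]FF.
exact: Re_mxtrace_mulX_le.
Qed.

Lemma sum_qform_row n (W X : 'M[C]_n) : W \is unitarymx ->
  \sum_k qform (row k W) X = complex.Re (\tr X).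
Proof.
move=> uW; under eq_bigr do rewrite qform_row; rewrite -Re_sum.
rewrite -[\sum_i _]/(\tr (W *m X *m W^t*)) mxtrace_mulC mulmxA.
by rewrite -(invmx_unitary uW) mulVmx ?mul1mx // unitarymx_unit.
Qed.

Lemma row_unitarymx n (W : 'M[C]_n) k :
  W \is unitarymx -> row k W *m (row k W)^t* = 1%:M.
Proof.
move=> /unitarymxP WW; apply/matrixP => i j; rewrite !ord1.
move/matrixP/(_ k k): WW; rewrite !mxE !eqxx /= => <-.
by apply: eq_bigr => l _; rewrite !mxE.
Qed.

(** [X Y] need not be Hermitian, so a first squaring passes to [(X Y)(X Y)^*], where Jensen applies;
    hence the exponent [j.+1]. Summing over the orthonormal rows of [W] gives the trace. *)
Lemma sum_qform_dyadic_le n (W : 'M[C]_n) (E F : nat -> 'M[C]_n) j :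
    W \is unitarymx ->
    (forall i, (E i)^t* = E i) -> (forall i, (F i)^t* = F i) ->
    (forall i, E i.+1 *m E i.+1 = E i) -> (forall i, F i.+1 *m F i.+1 = F i) ->
  \sum_k qform (row k W) (E j.+1 *m F j.+1) ^+ (2 ^ j.+1) <=
  complex.Re (\tr (E 0 *m F 0)).
Proof.
move=> uW hE hF EE FF; apply: le_trans (Re_mxtrace_dyadic_le j hE hF EE FF).
rewrite -[E j]EE -[F j]FF; set X := E j.+1; set Y := F j.+1.
have hX : X^t* = X by exact: hE.
have hY : Y^t* = Y by exact: hF.
have -> : \tr ((X *m X *m (Y *m Y)) ^+ (2 ^ j)) =
    \tr (((X *m Y) *m (X *m Y)^t*) ^+ (2 ^ j)).
  by rewrite adj_mul hX hY -!mulmxA mxtrace_mulX_comm !mulmxA.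
rewrite -(sum_qform_row _ uW); apply: ler_sum => k _.
have v1 := row_unitarymx k uW.
rewrite expnS exprM.
have ZZ : ((X *m Y) *m (X *m Y)^t*)^t* = (X *m Y) *m (X *m Y)^t*.
  by rewrite adj_mul trmxCK.
apply: le_trans (qformX_le j v1 ZZ).
rewrite lerXn2r ?nnegrE ?sqr_ge0 ?qform_mul_adj_ge0 //.
exact: qform_sqr_le.
Qed.

Lemma fcalc_expR_half n (A : 'M[C]_n) (a : R -> R) t :
  fcalc (fun x => expR (t / 2 * a x)) A *m fcalc (fun x => expR (t / 2 * a x)) A =
  fcalc (fun x => expR (t * a x)) A.
Proof.
by rewrite fcalcM; apply: eq_fcalc => i; rewrite -expRD -mulrDl -splitr.
Qed.

(* Golden-Thompson combined with Peierls' inequality; it avoids the matrix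
   exponential of a sum, hence the Lie-Trotter formula. *)
Lemma Golden_Thompson_Peierls n (W A B : 'M[C]_n) (a b : R -> R) :
    W \is unitarymx ->
  \sum_k expR (qform (row k W) (fcalc a A) + qform (row k W) (fcalc b B)) <=
  complex.Re (\tr (fcalc (expR \o a) A *m fcalc (expR \o b) B)).
Proof.
move=> uW; set T := complex.Re _.
pose h k := qform (row k W) (fcalc a A) + qform (row k W) (fcalc b B).
pose c k := (qform (row k W) (fcalc (expdev a) A)
             + qform (row k W) (fcalc (expdev b) B)) / 2.
have sq0 f X k : 0 <= qform (row k W) (fcalc (expdev f) X).
  rewrite -(qform_cst 0 (row_unitarymx k uW)) -(fcalc_cst 0 X).
  by apply: ler_qform_fcalc => x; exact: sqr_ge0.
have /fin_all_exists2[K K0 KP] k := @expR_le_exprn (h k) (c k)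
  (divr_ge0 (addr_ge0 (sq0 a A k) (sq0 b B k)) (ler0n _ 2)).
(* Recursive, so that [t i.+1] unfolds to [t i / 2], the form that [fcalc_expR_half] provides. *)
pose t := fix t (i : nat) : R := if i is i'.+1 then t i' / 2 else 1.
have tE i : t i = (2 ^ i)%:R^-1.
  elim: i => [|i /= ->]; first by rewrite expn0 invr1.
  by rewrite expnS natrM invfM mulrC.
have bound j : \sum_k K k <= (2 ^ j.+1)%:R ->
    \sum_k expR (h k) * (1 - K k / (2 ^ j.+1)%:R) <= T.
  move=> Kj.
  have t0 f (X : 'M[C]_n) : fcalc (fun x => expR (t 0 * f x)) X = fcalc (expR \o f) X.
    by apply: eq_fcalc => i; rewrite mul1r.
  have <- : _ = T :=
    congr2 (fun X Y => complex.Re (\tr (X *m Y))) (t0 a A) (t0 b B).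
  have := sum_qform_dyadic_le j uW
    (fun i => fcalc_adj (fun x => expR (t i * a x)) A)
    (fun i => fcalc_adj (fun x => expR (t i * b x)) B)
    (fun i => fcalc_expR_half A a (t i)) (fun i => fcalc_expR_half B b (t i)).
  apply: le_trans; apply: ler_sum => k _.
  have M0 : (0 < 2 ^ j.+1)%N by rewrite expn_gt0.
  have KM : K k <= (2 ^ j.+1)%:R.
    by apply: le_trans Kj; rewrite (bigD1 k) //= lerDl; apply: sumr_ge0.
  have t01 : 0 <= t j.+1 <= 1.
    by rewrite tE invr_ge0 ler0n invf_le1 ?ltr0n // ler1n.
  apply: (KP k _ _ M0 KM); rewrite -tE.
  exact: (qform_expR_mul_ge A B a b (row_unitarymx k uW) t01).
apply/ler_addgt0Pr => e e0.
set L := \sum_k expR (h k) * K k.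
have L0 : 0 <= L by apply: sumr_ge0 => k _; rewrite mulr_ge0 ?expR_ge0.
(* Large enough both for [bound] to apply (the sum of the [K k]) and for the error [L / 2^(m+1)] to
   be at most [e]. *)
pose m := Num.bound (\sum_k K k + L / e).
have sK0 : 0 <= \sum_k K k by apply: sumr_ge0.
have big : \sum_k K k + L / e <= (2 ^ m.+1)%:R.
  apply/ltW/(lt_le_trans (archi_boundP _)); first by rewrite addr_ge0 // divr_ge0 // ltW.
  by rewrite ler_nat (leq_trans (ltnW (ltn_expl _ (ltnSn 1)))) // leq_exp2l.
have M0 : 0 < (2 ^ m.+1)%:R :> R by rewrite ltr0n expn_gt0.
have Le0 : 0 <= L / e by rewrite divr_ge0 // ltW.
have := bound m (le_trans _ big); rewrite lerDl => /(_ Le0) Tm.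
apply: le_trans (lerD Tm (lexx e)).
rewrite -lerBlDl -sumrB.
apply: (@le_trans _ _ (L / (2 ^ m.+1)%:R)).
  rewrite /L mulr_suml; apply: ler_sum => k _.
  by rewrite -/(h k) mulrBr mulr1 opprB addrC subrK mulrA.
rewrite ler_pdivrMr // mulrC -ler_pdivrMr //.
by apply: le_trans big; rewrite lerDr.
Qed.

End GoldenThompsonPeierls.

(** * Relative entropy and overlaps *)

Section RelativeEntropy.
Local Open Scope sesquilinear_scope.
Context {R : realType}.
Local Notation C := R[i].

(** After normalisation by the partition function [Z], the inequality [1 + x <= e^x] is applied term
    by term. *)
Lemma Gibbs_variational n (s h : 'I_n -> R) :
    (forall k, 0 <= s k) -> \sum_k s k = 1 ->
  expR (\sum_k s k * (h k - ln (s k))) <= \sum_k expR (h k).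
Proof.
case: n s h => [|n] s h s0 s1.
  by move: s1; rewrite big_ord0 => /esym/eqP; rewrite oner_eq0.
set Z := \sum_k expR (h k).
have Z0 : 0 < Z.
  rewrite /Z (bigD1 ord0) //= ltr_pwDl ?expR_gt0 //.
  by apply: sumr_ge0 => k _; exact: expR_ge0.
rewrite -[leRHS]lnK ?posrE // ler_expR -subr_le0.
have -> : \sum_k s k * (h k - ln (s k)) - ln Z =
    \sum_k s k * (h k - ln (s k) - ln Z).
  by rewrite -[ln Z in LHS]mul1r -s1 mulr_suml -sumrB; apply: eq_bigr => k _; ring.
(* Both [expR (h k) / Z] and [s k] have total mass 1, so 0 is the sum of their differences and the
   comparison becomes termwise. *)
rewrite -[leRHS](_ : \sum_k (expR (h k) / Z - s k) = 0); last first.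
  by rewrite sumrB -mulr_suml s1 mulfV ?subrr // gt_eqF.
apply: ler_sum => k _; have := s0 k; rewrite le_eqVlt => /predU1P[<-|sk].
  by rewrite mul0r subr0 divr_ge0 ?expR_ge0 // ltW.
have -> : expR (h k) / Z - s k = s k * (expR (h k - ln (s k) - ln Z) - 1).
  by rewrite !expRB !lnK ?posrE //; field; rewrite !gt_eqF.
by rewrite ler_pM2l // lerBrDl expR_ge1Dx.
Qed.

Lemma row_spectralmx_mul n (A : 'M[C]_n) i : A \is hermsymmx ->
  row i (spectralmx A) *m A = (eigval A i)%:C%C *: row i (spectralmx A).
Proof.
move=> hA; have := fcalc_id hA; rewrite fcalcE.
move: (spectralmx A) (spectralmxKV A) (eigval A) => U UU e /esym AE.
rewrite -row_mul AE !mulmxA UU mul1mx.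
by apply/rowP => j; rewrite /rdiag mul_diag_mx !mxE.
Qed.

(** [sigma] annihilates the eigenvectors of [rho] with eigenvalue 0, so it sees the function at
    positive eigenvalues only. This permits changing the logarithm on the kernel. *)
Lemma mul_fcalc_supp n (sigma rho : 'M[C]_n) f g :
    sigma \is hermsymmx -> psdmx rho ->
    (forall v : 'rV_n, v *m rho = 0 -> v *m sigma = 0) ->
    (forall x, 0 < x -> f x = g x) ->
  sigma *m fcalc f rho = sigma *m fcalc g rho.
Proof.
move=> /hermsymmxP hs pr ker fg.
suff : sigma *m (spectralmx rho)^t* *m rdiag (fun i => f (eigval rho i)) =
    sigma *m (spectralmx rho)^t* *m rdiag (fun i => g (eigval rho i)).
  rewrite (fcalcE f) (fcalcE g).
  move: (rdiag _) (rdiag _) (spectralmx rho) => D E U DE.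
  by rewrite !mulmxA DE.
apply/matrixP => i j; rewrite /rdiag !mul_mx_diag !mxE.
have := psdmx_eigval_ge0 j pr; rewrite le_eqVlt => /predU1P[ej|ej]; last first.
  by rewrite fg.
have : row j (spectralmx rho) *m sigma = 0.
  by apply: ker; rewrite row_spectralmx_mul ?psdmx_herm // -ej scale0r.
rewrite -{1}hs => /(congr1 (fun M : 'rV[C]_n => M^t*)).
rewrite adj_mul trmxCK trmx0 map_mx0 => /matrixP/(_ i 0); rewrite !mxE => sj.
suff -> : \sum_l sigma i l * (spectralmx rho)^t* l j = 0 by rewrite !mul0r.
by rewrite -[RHS]sj; apply: eq_bigr => l _; rewrite !mxE.
Qed.

(** The finite branch of [rel_entropy], with the trace split so that each logarithm can be treated
    separately. *)
Definition relent n (sigma rho : 'M[C]_n) : R :=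
  complex.Re (\tr (sigma *m fcalc (@ln R) sigma))
  - complex.Re (\tr (sigma *m fcalc (@ln R) rho)).

Lemma expR_ln_half (x : R) : 0 < x -> expR (ln x / 2) = Num.sqrt x.
Proof.
move=> x0; rewrite -[x in RHS]lnK ?posrE // [in RHS](splitr (ln x)) expRD.
by rewrite -expr2 sqrtr_sqr ger0_norm ?expR_ge0.
Qed.

Lemma Re_mxtrace_mul_pencil n (P P' Q Q' : 'M[C]_n) (d : R) :
  complex.Re (\tr ((P + d%:C%C *: P') *m (Q + d%:C%C *: Q'))) =
  complex.Re (\tr (P *m Q))
  + d * (complex.Re (\tr (P *m Q')) + complex.Re (\tr (P' *m Q)))
  + d ^+ 2 * complex.Re (\tr (P' *m Q')).
Proof.
rewrite mulmxDl !mulmxDr -!scalemxAr -!scalemxAl scalerA -rmorphM.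
move: (P *m Q) (P *m Q') (P' *m Q) (P' *m Q') => X1 X2 X3 X4.
rewrite !mxtraceD !mxtraceZ.
move: (\tr X1) (\tr X2) (\tr X3) (\tr X4) => x1 x2 x3 x4.
by rewrite !Re_add !Re_mulr_real; ring.
Qed.

(** Golden-Thompson-Peierls in the eigenbasis of [sigma], then Gibbs with its eigenvalues as
    weights, give the bound for regularised half-logarithms of [rho] and [tau]; the regularisation
    [d] then tends to 0. *)
Lemma expR_relent_le n (sigma rho tau : 'M[C]_n) :
    state sigma -> psdmx rho -> psdmx tau ->
    (forall v : 'rV_n, v *m rho = 0 -> v *m sigma = 0) ->
    (forall v : 'rV_n, v *m tau = 0 -> v *m sigma = 0) ->
  expR (- ((relent sigma rho + relent sigma tau) / 2)) <=
  complex.Re (\tr (fcalc Num.sqrt rho *m fcalc Num.sqrt tau)).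
Proof.
move=> [ps ts] pr pt kr kt; have hs := psdmx_herm ps.
set T := complex.Re _; set L := expR _.
(* With [ln d] on the kernel, the exponential is the square root plus [d] times the kernel
   projector; the default [ln 0 = 0] would leave the projector with coefficient 1. *)
pose reg d (x : R) : R := if 0 < x then ln x / 2 else ln d.
pose ind (x : R) : R := if 0 < x then 0 else 1.
have regE d (X : 'M[C]_n) : 0 < d -> psdmx X ->
    fcalc (expR \o reg d) X = fcalc Num.sqrt X + d%:C%C *: fcalc ind X.
  move=> d0 pX; rewrite fcalcZ fcalcD; apply: psdmx_eq_fcalc => // x x0.
  rewrite /= /reg /ind; case: ltP => [xp|xn]; first by rewrite mulr0 addr0 expR_ln_half.
  by rewrite ler0_sqrtr // add0r mulr1 lnK.
have trreg d X : psdmx X -> (forall v : 'rV_n, v *m X = 0 -> v *m sigma = 0) ->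
    complex.Re (\tr (sigma *m fcalc (reg d) X)) =
    complex.Re (\tr (sigma *m fcalc (@ln R) X)) / 2.
  move=> pX kX; have -> : sigma *m fcalc (reg d) X =
      sigma *m fcalc (fun x => 2^-1 * ln x) X.
    by apply: mul_fcalc_supp => // x x0; rewrite /reg x0 mulrC.
  by rewrite -fcalcZ -scalemxAr mxtraceZ Re_mulr_real mulrC.
pose e := eigval sigma; pose W := spectralmx sigma.
have trE X : complex.Re (\tr (sigma *m X)) = \sum_k e k * qform (row k W) X.
  by have := mxtrace_fcalc_mul id sigma X; rewrite fcalc_id.
have trln : complex.Re (\tr (sigma *m fcalc (@ln R) sigma)) = \sum_k e k * ln (e k).
  rewrite -(mxtrace_fcalc (fun x => x * ln x)) -{1}(fcalc_id hs).
  by rewrite fcalcM.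
have e1 : \sum_k e k = 1.
  by rewrite -(mxtrace_fcalc id) fcalc_id // ts.
have LE d : 0 < d -> L <= complex.Re (\tr (fcalc (expR \o reg d) rho
    *m fcalc (expR \o reg d) tau)).
  move=> d0; apply: le_trans (Golden_Thompson_Peierls rho tau (reg d) (reg d)
    (spectral_unitarymx sigma)).
  apply: le_trans (Gibbs_variational _ (fun k => psdmx_eigval_ge0 k ps) e1).
  have Er := etrans (esym (trE _)) (trreg d _ pr kr).
  have Et := etrans (esym (trE _)) (trreg d _ pt kt).
  rewrite ler_expR /relent; under eq_bigr do rewrite mulrBr mulrDr.
  rewrite sumrB big_split /= Er Et -trln.
  move: (complex.Re _) (complex.Re _) (complex.Re _) => x y z.
  by clear; lra.
(* The regularised overlap is a quadratic polynomial in [d] with constant term [T]. *)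
have [c1 [c2 LE2]] : exists c1, exists c2, forall d, 0 < d ->
    L <= T + d * c1 + d ^+ 2 * c2.
  eexists; eexists => d d0; have := LE d d0.
  rewrite (regE d rho) // (regE d tau) // Re_mxtrace_mul_pencil; apply.
apply/ler_addgt0Pr => eps eps0.
pose c := `|c1| + `|c2| + 1.
have c0 : 0 < c by rewrite ltr_wpDl // addr_ge0.
(* [d <= 1] bounds [d^2] by [d]; the 1 added in [c] keeps the divisor positive. *)
pose d := Num.min 1 (eps / c).
have d0 : 0 < d by rewrite /d lt_min ltr01 divr_gt0.
have d1 : d <= 1 by rewrite /d ge_min lexx.
have dc : d * c <= eps by rewrite -ler_pdivlMr // /d ge_min lexx orbT.
apply: le_trans (LE2 d d0) _; rewrite -addrA lerD2l; apply: le_trans dc.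
have h1 : d * c1 <= d * `|c1| by rewrite ler_pM2l // ler_norm.
have h2 : d ^+ 2 * c2 <= d * `|c2|.
  apply: (@le_trans _ _ (d ^+ 2 * `|c2|)); first by rewrite ler_pM2l ?exprn_gt0 // ler_norm.
  by rewrite ler_wpM2r // expr2 ler_piMr // ltW.
by rewrite /c; lra.
Qed.

End RelativeEntropy.

(** * Block-diagonal operators *)

Section BlockDiagonal.
Local Open Scope sesquilinear_scope.
Context {R : realType}.
Local Notation C := R[i].

Definition bdiag r d (B : 'I_r -> 'M[C]_d) : 'M[C]_(r * d) :=
  \sum_i (delta_mx i i *t B i).

Lemma bdiagE r d (B : 'I_r -> 'M[C]_d) i j k l :
  bdiag B (mxtens_index (i, k)) (mxtens_index (j, l)) = B i k l *+ (i == j).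
Proof.
rewrite summxE (bigD1 i) //= tensmxE mxE eqxx /= mulr_natl eq_sym.
rewrite big1 ?addr0 // => m mi.
by rewrite tensmxE mxE eq_sym (negPf mi) mul0r.
Qed.

Lemma bdiagP r d (A B : 'M[C]_(r * d)) :
  (forall i k j l, A (mxtens_index (i, k)) (mxtens_index (j, l))
                 = B (mxtens_index (i, k)) (mxtens_index (j, l))) -> A = B.
Proof.
move=> AB; apply/matrixP => x y.
by case: (mxtens_indexP x) => i k; case: (mxtens_indexP y) => j l.
Qed.

Lemma eq_bdiag r d (A B : 'I_r -> 'M[C]_d) : A =1 B -> bdiag A = bdiag B.
Proof. by move=> AB; apply: eq_bigr => i _; rewrite AB. Qed.

Lemma bdiag_mul r d (A B : 'I_r -> 'M[C]_d) :
  bdiag A *m bdiag B = bdiag (fun i => A i *m B i).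
Proof.
rewrite mulmx_suml; apply: eq_bigr => i _.
rewrite mulmx_sumr (bigD1 i) //= tensmx_mul mul_delta_mx.
rewrite big1 ?addr0 // => j ji.
by rewrite tensmx_mul mul_delta_mx_0 1?eq_sym // tens0mx.
Qed.

Lemma bdiag1 r d : bdiag (fun _ : 'I_r => 1%:M : 'M[C]_d) = 1%:M.
Proof.
apply: bdiagP => i k j l; rewrite bdiagE !mxE.
by rewrite (can_eq (@mxtens_indexK _ _)) xpair_eqE -mulrnA mulnb andbC.
Qed.

Lemma bdiag_adj r d (A : 'I_r -> 'M[C]_d) :
  (bdiag A)^t* = bdiag (fun i => (A i)^t*).
Proof.
apply: bdiagP => i k j l; rewrite !mxE !bdiagE !mxE eq_sym.
by case: eqP => [->|_]; rewrite ?mulr1n // !mulr0n conjC0.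
Qed.

Lemma sum_mxtens_index r d (F : 'I_(r * d) -> C) :
  \sum_x F x = \sum_i \sum_k F (mxtens_index (i, k)).
Proof.
rewrite pair_big /= (reindex (@mxtens_index r d)) /=.
  by apply: eq_bigr => -[].
by exists (@mxtens_unindex r d) => x _; rewrite ?mxtens_indexK ?mxtens_unindexK.
Qed.

Lemma mxtrace_bdiag r d (A : 'I_r -> 'M[C]_d) :
  \tr (bdiag A) = \sum_i \tr (A i).
Proof.
rewrite /mxtrace sum_mxtens_index; apply: eq_bigr => i _.
by apply: eq_bigr => k _; rewrite bdiagE eqxx.
Qed.

Lemma bdiag_rdiag r d (e : 'I_r -> 'I_d -> R) :
  bdiag (fun i => rdiag (e i)) =
  rdiag (fun x => e (mxtens_unindex x).1 (mxtens_unindex x).2).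
Proof.
apply: bdiagP => i k j l; rewrite bdiagE !rdiagE mxtens_indexK /=.
by rewrite (can_eq (@mxtens_indexK _ _)) xpair_eqE -mulrnA mulnb andbC.
Qed.

Lemma bdiag_herm r d (A : 'I_r -> 'M[C]_d) :
  (forall i, A i \is hermsymmx) -> bdiag A \is hermsymmx.
Proof.
move=> hA; apply/hermsymmxP; rewrite bdiag_adj; apply: eq_bdiag => i.
exact/hermsymmxP.
Qed.

(** The spectral matrix of [bdiag A] need not be block diagonal, so the calculus is computed from
    another diagonalisation, by the block matrix of the spectral matrices of the [A i]. *)
Lemma fcalc_bdiag f r d (A : 'I_r -> 'M[C]_d) :
    (forall i, A i \is hermsymmx) ->
  fcalc f (bdiag A) = bdiag (fun i => fcalc f (A i)).
Proof.
move=> hA; pose V := bdiag (fun i => spectralmx (A i)).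
have VK : bdiag (fun i => (spectralmx (A i))^t*) *m V = 1%:M.
  rewrite bdiag_mul -bdiag1; apply: eq_bdiag => i; exact: spectralmxVK.
have uV : V \in unitmx by case/mulmx1_unit: VK.
have iV : invmx V = bdiag (fun i => (spectralmx (A i))^t*).
  by rewrite -[RHS](mulmxK uV) VK mul1mx.
pose e (x : 'I_(r * d)) := eigval (A (mxtens_unindex x).1) (mxtens_unindex x).2.
(* Used at [id] to diagonalise [bdiag A] itself, and at [f] for the conclusion. *)
have conj g : invmx V *m rdiag (fun x => g (e x)) *m V =
    bdiag (fun i => fcalc g (A i)).
  rewrite iV -(bdiag_rdiag (fun i k => g (eigval (A i) k))) !bdiag_mul.
  by apply: eq_bdiag => i; rewrite fcalcE.
rewrite -conj; apply: fcalc_diagonalization => //; first exact: bdiag_herm.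
by rewrite (conj id); apply: eq_bdiag => i; rewrite fcalc_id.
Qed.

(** Test the hypothesis on the tensor product of the [i]-th basis vector with [v]. *)
Lemma bdiag_ker r d (A B : 'I_r -> 'M[C]_d) i :
    (forall v : 'rV_(r * d), v *m bdiag A = 0 -> v *m bdiag B = 0) ->
  forall v : 'rV_d, v *m A i = 0 -> v *m B i = 0.
Proof.
move=> ker v vA.
have mulE (D : 'I_r -> 'M[C]_d) :
    (delta_mx 0 i *t v : 'M[C]_(1 * 1, r * d)) *m bdiag D =
    (delta_mx 0 i : 'rV_r) *t (v *m D i).
  rewrite mulmx_sumr (bigD1 i) //= tensmx_mul mul_delta_mx.
  rewrite big1 ?addr0 // => j ji.
  by rewrite tensmx_mul mul_delta_mx_0 1?eq_sym // tens0mx.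
have : (delta_mx 0 i *t v : 'M[C]_(1 * 1, r * d)) *m bdiag B = 0.
  by apply: ker; rewrite mulE vA tensmx0.
rewrite mulE => /matrixP E; apply/rowP => k.
have := E (mxtens_index (0, 0)) (mxtens_index (i, k)).
by rewrite tensmxE !mxE !eqxx mul1r.
Qed.

Lemma suppmx_sub_ker n (A B : 'M[C]_n) : (suppmx A <= suppmx B)%MS ->
  forall v : 'rV_n, v *m B = 0 -> v *m A = 0.
Proof.
rewrite /suppmx => AB v vB.
have kBA : (kermx B <= kermx A)%MS by rewrite -submx_ortho.
by apply/sub_kermxP; apply: submx_trans kBA; apply/sub_kermxP.
Qed.

Lemma relentE n (A B : 'M[C]_n) :
  complex.Re (\tr (A *m (lnmx A - lnmx B))) = relent A B.
Proof.
rewrite /lnmx !fun_mx_fcalc mulmxBr /relent.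
move: (A *m fcalc (@ln R) A) (A *m fcalc (@ln R) B) => X Y.
by rewrite raddfB /= Re_add Re_opp.
Qed.

Lemma relent_bdiag r d (A B : 'I_r -> 'M[C]_d) :
    (forall i, A i \is hermsymmx) -> (forall i, B i \is hermsymmx) ->
  relent (bdiag A) (bdiag B) = \sum_i relent (A i) (B i).
Proof.
move=> hA hB; rewrite /relent (fcalc_bdiag _ hA) (fcalc_bdiag _ hB).
rewrite !bdiag_mul.
by rewrite (mxtrace_bdiag (fun i => A i *m fcalc (@ln R) (A i)))
  (mxtrace_bdiag (fun i => A i *m fcalc (@ln R) (B i))) !Re_sum sumrB.
Qed.

(** Both traces acquire the same multiple of [ln c], which cancels. The kernel condition enters
    because [ln (c * x) = ln c + ln x] can fail at 0 under [ln 0 = 0]. *)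
Lemma relent_scale n (c : R) (A B : 'M[C]_n) : 0 < c -> psdmx A -> psdmx B ->
    (forall v : 'rV_n, v *m B = 0 -> v *m A = 0) ->
  relent (c%:C%C *: A) (c%:C%C *: B) = c * relent A B.
Proof.
move=> c0 pA pB ker.
have aux X : psdmx X -> (forall v : 'rV_n, v *m X = 0 -> v *m A = 0) ->
    complex.Re (\tr ((c%:C%C *: A) *m fcalc (@ln R) (c%:C%C *: X))) =
    c * (ln c * complex.Re (\tr A) + complex.Re (\tr (A *m fcalc (@ln R) X))).
  move=> pX kX; rewrite (fcalc_scale _ _ (psdmx_herm pX)) -scalemxAl.
  have -> : A *m fcalc (fun x => ln (c * x)) X =
      A *m fcalc (fun x => ln c + ln x) X.
    by apply: mul_fcalc_supp => // [|x x0]; [exact: psdmx_herm | rewrite lnM].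
  rewrite -fcalcD fcalc_cst mulmxDr mul_mx_scalar.
  move: (A *m fcalc (@ln R) X) => Y.
  by rewrite mxtraceZ mxtraceD mxtraceZ Re_mulr_real Re_add Re_mulr_real.
by rewrite /relent !aux //; ring.
Qed.

End BlockDiagonal.

(** * Classical-quantum states, square-root overlaps and averages over pairs *)

Section CqStates.
Local Open Scope sesquilinear_scope.
Context {R : realType}.
Local Notation C := R[i].

Lemma cq_stateE r d (rho : 'I_r -> 'M[C]_d) :
  cq_state rho = bdiag (fun i => (r%:R^-1 : R)%:C%C *: rho i).
Proof.
apply: bdiagP => i k j l; rewrite bdiagE mxE -/(bdiag rho) bdiagE mxE.
by rewrite fmorphV rmorph_nat mulrnAr.
Qed.

(** Unit traces make [rho_X] the maximally mixed state, which contributes [1/r] to every block. *)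
Lemma ptraceA_cq_tens r d (rho : 'I_r -> 'M[C]_d) (sigma : 'M[C]_d) :
    (forall i, \tr (rho i) = 1) ->
  ptraceA (cq_state rho) *t sigma =
  bdiag (fun=> (r%:R^-1 : R)%:C%C *: sigma).
Proof.
move=> tr1; apply: bdiagP => i k j l; rewrite bdiagE tensmxE mxE.
rewrite cq_stateE; under eq_bigr do rewrite bdiagE mxE.
rewrite sumrMnl -mulr_sumr -[\sum_m _]/(\tr (rho i)) tr1 mulr1.
by rewrite mxE mulrnAl.
Qed.

Definition half_overlap n (rho sigma : 'M[C]_n) : R :=
  complex.Re (\tr (fcalc Num.sqrt rho *m fcalc Num.sqrt sigma)).

Lemma half_overlap_ge0 n (rho sigma : 'M[C]_n) : 0 <= half_overlap rho sigma.
Proof.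
rewrite /half_overlap mxtrace_fcalc_mul; apply: sumr_ge0 => i _.
rewrite mulr_ge0 ?sqrtr_ge0 // qform_fcalc; apply: sumr_ge0 => k _.
by rewrite mulr_ge0 ?sqrtr_ge0 ?normsq_ge0.
Qed.

Lemma fcalc_sqrt_sqr n (A : 'M[C]_n) : psdmx A ->
  fcalc Num.sqrt A *m fcalc Num.sqrt A = A.
Proof.
move=> pA; rewrite fcalcM -[RHS](fcalc_id (psdmx_herm pA)).
by apply: psdmx_eq_fcalc => // x x0; rewrite -expr2 sqr_sqrtr.
Qed.

Lemma half_overlap_diag n (rho : 'M[C]_n) : state rho -> half_overlap rho rho = 1.
Proof. by move=> [pr tr1]; rewrite /half_overlap fcalc_sqrt_sqr // tr1. Qed.

Lemma fcalc_sqrt_scale n (A : 'M[C]_n) (c : R) : 0 <= c -> psdmx A ->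
  fcalc Num.sqrt (c%:C%C *: A) = (Num.sqrt c)%:C%C *: fcalc Num.sqrt A.
Proof.
move=> c0 pA; rewrite fcalc_scale ?psdmx_herm // fcalcZ.
by apply: psdmx_eq_fcalc => // x x0; rewrite sqrtrM.
Qed.

Lemma half_overlap_cq r d (rho : 'I_r -> 'M[C]_d) (sigma : 'M[C]_d) (c : R) :
    0 <= c -> (forall i, psdmx (rho i)) -> psdmx sigma ->
  half_overlap (bdiag (fun i => c%:C%C *: rho i)) (bdiag (fun=> c%:C%C *: sigma)) =
  c * \sum_i half_overlap (rho i) sigma.
Proof.
move=> c0 pr ps; rewrite /half_overlap.
have hZ A : psdmx A -> c%:C%C *: A \is hermsymmx :> bool.
  move=> pA; rewrite -[A](fcalc_id (psdmx_herm pA)) fcalcZ; exact: fcalc_herm.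
rewrite (fcalc_bdiag _ (fun i => hZ _ _ (pr i))).
rewrite (@fcalc_bdiag _ _ r _ (fun=> c%:C%C *: sigma) (fun=> hZ _ _ ps)).
rewrite bdiag_mul mxtrace_bdiag Re_sum mulr_sumr; apply: eq_bigr => i _.
rewrite !fcalc_sqrt_scale // -scalemxAl -scalemxAr scalerA -rmorphM -expr2.
by rewrite sqr_sqrtr // mxtraceZ Re_mulr_real.
Qed.

Lemma psdmx_sum I (s : seq I) n (A : I -> 'M[C]_n) :
  (forall i, psdmx (A i)) -> psdmx (\sum_(i <- s) A i).
Proof.
move=> pA; elim/big_ind: _ => //.
- split=> [|v]; last by rewrite mulmx0 mul0mx mxE.
  by apply/hermsymmxP; rewrite trmx0 map_mx0.
- move=> X Y [/hermsymmxP hX pX] [/hermsymmxP hY pY]; split=> [|v].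
    by apply/hermsymmxP; rewrite linearD /= map_mxD hX hY.
  by rewrite mulmxDr mulmxDl mxE addr_ge0.
Qed.

(** The witness is [S^2 / N]; since [S] is positive semi-definite, [S / sqrt N] is its positive
    square root. *)
Lemma exists_state_sqrt n (S : 'M[C]_n) (N : R) :
    psdmx S -> 0 < N -> N = complex.Re (\tr (S *m S)) ->
  exists2 sigma : 'M[C]_n, state sigma &
    fcalc Num.sqrt sigma = (Num.sqrt N)^-1%:C%C *: S.
Proof.
move=> pS N0 NE; have hS := psdmx_herm pS.
have trSS : \tr (S *m S) = N%:C%C.
  rewrite NE RRe_real // realE; apply/orP; left.
  by rewrite -{2}(hermsymmxP _ hS) mxtrace_mul_adj_ge0.
have SE : N^-1%:C%C *: (S *m S) = fcalc (fun x => N^-1 * (x * x)) S.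
  by rewrite -fcalcZ -fcalcM !fcalc_id.
exists (N^-1%:C%C *: (S *m S)).
  split; last by rewrite mxtraceZ trSS -rmorphM mulVf // gt_eqF.
  rewrite SE; apply: psdmx_fcalc => i.
  by rewrite mulr_ge0 ?invr_ge0 ?(ltW N0) // -expr2 sqr_ge0.
rewrite SE fcalc_comp -{2}(fcalc_id hS) fcalcZ.
apply: psdmx_eq_fcalc => // x x0.
rewrite sqrtrM ?invr_ge0 ?(ltW N0) // sqrtrV ?(ltW N0) //.
by rewrite -expr2 sqrtr_sqr ger0_norm.
Qed.

Lemma sum_half_overlap n r (rho : 'I_r -> 'M[C]_n) :
  complex.Re (\tr ((\sum_i fcalc Num.sqrt (rho i))
                   *m (\sum_i fcalc Num.sqrt (rho i)))) =
  \sum_i \sum_j half_overlap (rho i) (rho j).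
Proof.
have tr_sum (F : 'I_r -> 'M[C]_n) : \tr (\sum_i F i) = \sum_i \tr (F i).
  by rewrite raddf_sum.
rewrite mulmx_suml tr_sum Re_sum; apply: eq_bigr => i _.
by rewrite mulmx_sumr tr_sum Re_sum.
Qed.

(** Jensen's inequality for [exp] through its tangent line at the mean [- m]. Every index lies in
    equally many ordered pairs, so the linear deviations sum to zero. *)
Lemma expR_pair_average r (D : 'I_r -> R) : (2 <= r)%N ->
  (r * r.-1)%:R * expR (- (r%:R^-1 * \sum_i D i)) <=
  \sum_i \sum_(j | j != i) expR (- ((D i + D j) / 2)).
Proof.
move=> r2; set m := r%:R^-1 * _.
have r0 : r%:R != 0 :> R by rewrite pnatr_eq0; case: r r2 {D m}.
have mr : \sum_i D i = r%:R * m by rewrite /m mulrA mulfV // mul1r.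
have r1 : (r.-1)%:R = r%:R - 1 :> R.
  by rewrite -[in LHS]subn1 natrB // ltnW.
have card1 (i : 'I_r) (c : R) : \sum_(j | j != i) c = (r%:R - 1) * c.
  rewrite sumr_const (_ : #|_| = r.-1); last by rewrite cardC1 card_ord.
  by rewrite -[c *+ _]mulr_natl r1.
have card0 (c : R) : \sum_(i < r) c = r%:R * c.
  by rewrite sumr_const card_ord -[c *+ r]mulr_natl.
apply: (@le_trans _ _ (\sum_i \sum_(j | j != i)
    expR (- m) * (1 + (m - (D i + D j) / 2)))).
  under eq_bigr do rewrite -mulr_sumr.
  rewrite -mulr_sumr mulrC ler_pM2l ?expR_gt0 //.
  have rowE i : \sum_(j | j != i) (1 + (m - (D i + D j) / 2)) =
      (r%:R - 1) * (1 + m - D i / 2) - (r%:R * m - D i) / 2.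
    have -> : r%:R * m - D i = \sum_(j | j != i) D j.
      by rewrite -mr [X in X - _](bigD1 i) //= addrAC subrr add0r.
    by rewrite mulr_suml -(card1 i) -sumrB; apply: eq_bigr => j _; lra.
  under eq_bigr do rewrite rowE.
  have -> : \sum_i ((r%:R - 1) * (1 + m - D i / 2) - (r%:R * m - D i) / 2) =
      \sum_i (((r%:R - 1) * (1 + m) - r%:R * m / 2) + (1 - r%:R / 2) * D i).
    by apply: eq_bigr => i _; lra.
  rewrite big_split /= -mulr_sumr mr card0.
  rewrite natrM r1 le_eqVlt; apply/orP; left.
  by apply/eqP; field.
apply: ler_sum => i _; apply: ler_sum => j _.
rewrite [X in _ <= expR X](_ : _ = - m + (m - (D i + D j) / 2)); last by lra.
by rewrite expRD ler_pM2l ?expR_gt0 // expR_ge1Dx.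
Qed.

End CqStates.

(** * The two sides of the theorem bounded by the average pair overlap *)

Section Overlaps.
Local Open Scope sesquilinear_scope.
Context {R : realType} {r d : nat} (rho : 'I_r -> 'M[R[i]]_d).
Context (r2 : (2 <= r)%N) (hrho : forall i, state (rho i)).
Local Notation C := R[i].

Let c : R := r%:R^-1.

Let r_gt0 : 0 < r%:R :> R.
Proof. by rewrite ltr0n ltnW. Qed.

Let c_gt0 : 0 < c.
Proof. by rewrite invr_gt0. Qed.

Let cpsd A : psdmx A -> @psdmx R d (c%:C%C *: A).
Proof.
move=> pA; rewrite -[A](fcalc_id (psdmx_herm pA)) fcalcZ.
by apply: psdmx_fcalc => i; rewrite mulr_ge0 ?psdmx_eigval_ge0 // ltW.
Qed.

Definition pair_overlap : R :=
  (\sum_i \sum_(j | j != i) half_overlap (rho i) (rho j)) / (r * r.-1)%:R.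

Lemma pair_overlap_ge0 : 0 <= pair_overlap.
Proof.
rewrite divr_ge0 ?ler0n //; do 2!apply: sumr_ge0 => ? _.
exact: half_overlap_ge0.
Qed.

Lemma expeR_oveloh_le :
  (expeR (- oveloh (cq_state rho)) <= pair_overlap%:E)%E.
Proof.
have X0 : pair_overlap%:E \in `[0%E, +oo%E].
  by rewrite in_itv /= lee_fin pair_overlap_ge0 leey.
(* [lneK] also covers overlap 0, where [lne] is [-oo]. It remains to bound each relative entropy
   from below, which is trivial where it is [+oo]. *)
rewrite -(lneK X0) lee_expeR leeNl; apply: le_ereal_inf_tmp => _ [sigma ssigma <-].
rewrite ptraceA_cq_tens; last by move=> i; case: (hrho i).
rewrite cq_stateE /rel_entropy; case: ifP => [supp|_]; last exact: leey.
have ps := ssigma.1; have pr i := (hrho i).1.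
(* The support condition on the block matrices, read block by block; the weight [1/r] is
   invertible. *)
have ker i (v : 'rV_d) : v *m rho i = 0 -> v *m sigma = 0.
  move=> v0; have := bdiag_ker (suppmx_sub_ker supp) (i := i) (v := v).
  rewrite -!scalemxAr v0 scaler0 => /(_ erefl)/eqP.
  rewrite scaler_eq0 => /orP[|/eqP //].
  by rewrite fmorph_eq0 gt_eqF.
rewrite relentE relent_bdiag => [|i|i]; [|exact/psdmx_herm/cpsd|exact/psdmx_herm/cpsd].
under eq_bigr => i _ do rewrite (relent_scale c_gt0 ps (pr i) (ker i)).
rewrite -mulr_sumr; set D := (fun i => relent sigma (rho i)).
have rr0 : 0 < (r * r.-1)%:R :> R.
  by rewrite ltr0n muln_gt0; case: r r2 => [|[|]].
have DX : expR (- (c * \sum_i D i)) <= pair_overlap.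
  rewrite /pair_overlap ler_pdivlMr // mulrC.
  apply: le_trans (expR_pair_average D r2) _.
  apply: ler_sum => i _; apply: ler_sum => j _.
  exact: expR_relent_le (ker i) (ker j).
(* By [DX] one finite relative entropy already forces a positive overlap, so [lne] is the real
   logarithm here. *)
rewrite leeNl lne_EFin ?(lt_le_trans (expR_gt0 _) DX) //.
by rewrite lee_fin -ler_expR lnK // posrE (lt_le_trans (expR_gt0 _) DX).
Qed.

Lemma sum_half_overlapE :
  \sum_i \sum_j half_overlap (rho i) (rho j) =
  r%:R + (r * r.-1)%:R * pair_overlap.
Proof.
under eq_bigr => i _ do rewrite (bigD1 i) //= half_overlap_diag //.
rewrite big_split /= sumr_const card_ord mulrC divfK //.
by rewrite pnatr_eq0 -lt0n muln_gt0; case: r r2 => [|[|]].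
Qed.

(** Test the infimum on the state proportional to [S^2], whose square root is a multiple of [S]. *)
Lemma expeR_petz_half_ge :
  ((c + (1 - c) * pair_overlap)%:E <=
    expeR (- ereal_inf [set petz_half (cq_state rho) (ptraceA (cq_state rho) *t sigma)
                       | sigma in [set sigma : 'M[C]_d | state sigma]]))%E.
Proof.
pose S := \sum_i fcalc Num.sqrt (rho i).
have pS : psdmx S.
  by apply: psdmx_sum => i; apply: psdmx_fcalc => k; exact: sqrtr_ge0.
pose N := complex.Re (\tr (S *m S)).
have NE : N = r%:R + (r * r.-1)%:R * pair_overlap.
  by rewrite -sum_half_overlapE /N sum_half_overlap.
have N0 : 0 < N by rewrite NE ltr_wpDr // mulr_ge0 ?pair_overlap_ge0.
have [sigma ssigma sqrt_sigma] := exists_state_sqrt pS N0 erefl.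
(* The sum of the overlaps is the trace of [S] times the square root of [sigma], that is
   [N / sqrt N]. *)
have FE : c * \sum_i half_overlap (rho i) sigma = c * Num.sqrt N.
  congr (_ * _); transitivity (complex.Re (\tr (S *m fcalc Num.sqrt sigma))).
    rewrite mulmx_suml (raddf_sum (@mxtrace C d)) Re_sum; exact: eq_bigr.
  rewrite sqrt_sigma -scalemxAr mxtraceZ Re_mulr_real -/N.
  by rewrite -{2}[N]sqr_sqrtr ?(ltW N0) // expr2 mulKf // gt_eqF ?sqrtr_gt0.
have F0 : 0 < c * Num.sqrt N by rewrite mulr_gt0 ?sqrtr_gt0.
apply: (@le_trans _ _ (expeR (- petz_half (cq_state rho)
    (ptraceA (cq_state rho) *t sigma)))); last first.
  by rewrite lee_expeR leeN2; apply: ereal_inf_lbound; exists sigma.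
rewrite ptraceA_cq_tens; last by move=> i; case: (hrho i).
rewrite cq_stateE /petz_half /sqrtmx !fun_mx_fcalc -/(half_overlap _ _).
rewrite half_overlap_cq ?(ltW c_gt0) //; last first.
- by case: ssigma.
- by move=> i; case: (hrho i).
rewrite -/c FE lne_EFin // -EFinM -EFinN /= lee_fin.
(* The factor 2 squares the overlap, and [c^2 N = c + (1 - c) pair_overlap]. *)
have -> : - (- 2 * ln (c * Num.sqrt N)) = ln (c * Num.sqrt N) + ln (c * Num.sqrt N).
  by lra.
rewrite expRD lnK ?posrE // -expr2 exprMn sqr_sqrtr ?(ltW N0) // NE.
have r1 : (r.-1)%:R = r%:R - 1 :> R by rewrite -[in LHS]subn1 natrB // ltnW.
rewrite natrM r1 le_eqVlt; apply/orP; left; apply/eqP; rewrite /c.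
by field; rewrite gt_eqF.
Qed.

End Overlaps.

Theorem mainTheorem14 (R : realType) (r d : nat) (hr : (2 <= r)%N)
    (rho : 'I_r -> 'M[R[i]]_d) (hrho : forall i, state (rho i)) :
  let rhoXA : 'M[R[i]]_(r * d) := cq_state rho in
  let rhoX : 'M[R[i]]_r := ptraceA rhoXA in
  ((r%:R^-1)%:E + ((r%:R - 1) / r%:R)%:E * expeR (- oveloh rhoXA)
   <= expeR (- ereal_inf [set petz_half rhoXA (rhoX *t sigma)
                         | sigma in [set sigma : 'M[R[i]]_d | state sigma]]))%E.
Proof.
(* The two sides are compared through [pair_overlap], whose coefficient [1 - 1/r] is nonnegative. *)
cbv zeta; apply: le_trans (expeR_petz_half_ge hr hrho).
have r0 : 0 < r%:R :> R by rewrite ltr0n ltnW.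
have -> : (r%:R - 1) / r%:R = 1 - r%:R^-1 :> R by rewrite mulrBl mulfV ?mul1r ?gt_eqF.
rewrite [leRHS]EFinD EFinM leeD2l // lee_wpmul2l //; last exact: expeR_oveloh_le.
by rewrite lee_fin subr_ge0 invf_le1 // ler1n ltnW.
Qed.
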